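(* Let $\phi=\{\phi_t:t\ge0\}$ be a pure CP semigroup which has no normal invariant state, and let $\alpha=\{\alpha_t:t\ge0\}$, acting on $\mathcal{B}(H)$, be its minimal dilation to an $E_0$-semigroup. Then $$\bigcap_{t\ge0}\alpha_t(\mathcal{B}(H))=\mathbb{C}\cdot\mathbf{1},$$ and $\alpha$ has no normal invariant state.
   Context: A CP semigroup on $\mathcal{B}(K)$ ($K$ a separable Hilbert space) is a semigroup $\phi=\{\phi_t:t\ge0\}$ (that is, $\phi_0=\mathrm{id}$ and $\phi_{s+t}=\phi_s\circ\phi_t$) of normal (i.e. weak$^*$-continuous) completely positive linear maps on $\mathcal{B}(K)$ with $\phi_t(\mathbf{1})=\mathbf{1}$, such that $t\mapsto\langle\phi_t(A)\xi,\eta\rangle$ is continuous for all $\xi,\eta\in K$, $A\in\mathcal{B}(K)$. It is called pure if for every pair of normal states $\rho_1,\rho_2$ of $\mathcal{B}(K)$ one has $\lim_{t\to\infty}\|\rho_1\circ\phi_t-\rho_2\circ\phi_t\|=0$. A normal invariant state is a normal state $\rho$ with $\rho\circ\phi_t=\rho$ for all $t\ge0$. An $E_0$-semigroup is a CP semigroup $\alpha=\{\alpha_t:t\ge0\}$ acting on some $\mathcal{B}(H)$ such that each $\alpha_t$ is multiplicative: $\alpha_t(AB)=\alpha_t(A)\alpha_t(B)$. Dilation: let $\phi$ act on $\mathcal{B}(K)$. An $E_0$-semigroup $\alpha$ acting on $\mathcal{B}(H)$, where $K\subseteq H$ is a closed subspace with orthogonal projection $P$ and $\mathcal{B}(K)$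 is identified with $P\mathcal{B}(H)P$, is a dilation of $\phi$ if $\phi$ is the compression of $\alpha$ to $\mathcal{B}(K)$, i.e. $\phi_t(A)=P\alpha_t(A)P$ for all $A\in P\mathcal{B}(H)P$, $t\ge0$ (then $\alpha_t(P)\ge P$ for all $t$ since $\phi_t$ is unital). The dilation is minimal if $H$ is the closed linear span of the vectors $\alpha_{t_1}(A_1)\alpha_{t_2}(A_2)\cdots\alpha_{t_n}(A_n)\xi$ with $n\ge1$, $t_i\ge0$, $A_i\in P\mathcal{B}(H)P$, $\xi\in K$. The minimal dilation of a CP semigroup exists and is unique up to conjugacy. *)

(* Defs.v *)
From HB Require Import structures.
From mathcomp Require Import all_boot all_order all_algebra.
From mathcomp Require Import all_classical all_reals all_analysis.
From mathcomp Require Import complex.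

Set Implicit Arguments.
Unset Strict Implicit.
Unset Printing Implicit Defensive.

Import Order.TTheory GRing.Theory Num.Theory.
Import numFieldNormedType.Exports.

Local Open Scope classical_set_scope.
Local Open Scope ring_scope.

(* R[i] has its usual topology, given by the modulus. *)
HB.instance Definition _ (R : realType) :=
  PseudoPointedMetric.copy R[i] R[i]^o.
HB.instance Definition _ (R : realType) := NormedModule.copy R[i] R[i]^o.

(* Inner products are linear in the first variable. *)
HB.mixin Record CompleteNormedModule_isHilbert (R : realType) V
    of CompleteNormedModule R[i] V := {
  hdot : {dot V for Num.conj} ;
  hnormE : forall x : V, `|x| ^+ 2 = hdot x x
}.

#[short(type="hilbertType")]
HB.structure Definition Hilbert (R : realType) :=
  {V of CompleteNormedModule R[i] V & CompleteNormedModule_isHilbert R V}.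

Definition separable (T : topologicalType) : Prop :=
  exists D : set T, countable D /\ dense D.

Section bounded_operators.
Context {C : numFieldType}.
Implicit Types E F G : normedModType C.

(* For linear maps between normed spaces, continuous means bounded. *)
Definition bounded_op E F : {pred E -> F} :=
  [pred f : E -> F | `[< linear f /\ continuous f >]].

Lemma bounded_opP E F (f : E -> F) :
  reflect (linear f /\ continuous f) (f \in @bounded_op E F).
Proof. exact: asboolP. Qed.

Lemma bounded_op_submod_closed E F : submod_closed (@bounded_op E F).
Proof.
split.
  apply/bounded_opP; split; last by move=> x; exact: cst_continuous.
  by move=> a x y; rewrite /= scaler0 addr0.
move=> a f g /bounded_opP[lf cf] /bounded_opP[lg cg].
apply/bounded_opP; split.
  move=> b x y; rewrite !fctE lf lg !scalerDr !scalerA (mulrC a b) -!addrA.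
  by congr (_ + _); rewrite addrCA.
move=> x; apply: (@continuousD _ _ _ (a *: f) g x); last exact: cg.
by apply: (@continuousZl_tmp _ _ _ f a x); exact: cf.
Qed.

HB.instance Definition _ E F := GRing.isSubmodClosed.Build C (E -> F)
  (@bounded_op E F) (@bounded_op_submod_closed E F).

Record bop E F := Bop { bop_fun :> E -> F ; _ : bop_fun \in @bounded_op E F }.

HB.instance Definition _ E F := [isSub for @bop_fun E F].
HB.instance Definition _ E F := [Choice of bop E F by <:].
HB.instance Definition _ E F := [SubChoice_isSubLmodule of bop E F by <:].

Lemma bop_id_subproof E : idfun \in @bounded_op E E.
Proof. by apply/bounded_opP; split => // x. Qed.

Definition bop_id E : bop E E := Bop (bop_id_subproof E).

Lemma bop_comp_subproof E F G (A : bop F G) (B : bop E F) :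
  A \o B \in @bounded_op E G.
Proof.
have /bounded_opP[la ca] := valP A; have /bounded_opP[lb cb] := valP B.
apply/bounded_opP; split.
  by move=> c x y; rewrite /= (lb c x y : B _ = _) (la _ _ _ : A _ = _).
by move=> x; apply: continuous_comp; [exact: cb|exact: ca].
Qed.

Definition bop_comp E F G (A : bop F G) (B : bop E F) : bop E G :=
  Bop (bop_comp_subproof A B).
End bounded_operators.

Notation "''B' ( K )" := (bop K K) (at level 8, format "''B' ( K )") : type_scope.
Notation "A *b B" := (bop_comp A B)
  (at level 40, left associativity, format "A  *b  B") : ring_scope.

Section operator_algebra.
Context {R : realType}.
Implicit Types K H : hilbertType R.

(* Norms are valued in R[i], hence the real parts. *)
Definition opnorm K (A : 'B(K)) : \bar R :=
  ereal_sup [set (complex.Re `|A x|)%:E | x in [set x : K | `|x| <= 1]].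

Definition functional_norm K (f : 'B(K) -> R[i]) : \bar R :=
  ereal_sup [set (complex.Re `|f A|)%:E | A in [set A | (opnorm A <= 1)%E]].

(* The order of R[i] is partial: [0 <= z] says that z is real and
   nonnegative. *)
Definition positive_op K (A : 'B(K)) : Prop := forall x : K, 0 <= hdot (A x) x.

(* Positivity of a matrix of operators, seen as an operator on K^n. *)
Definition positive_opmx K n (A : 'M['B(K)]_n) : Prop :=
  forall x : 'I_n -> K, 0 <= \sum_(i < n) \sum_(j < n) hdot (A i j (x j)) (x i).

Definition completely_positive K (f : 'B(K) -> 'B(K)) : Prop :=
  forall n (A : 'M['B(K)]_n), positive_opmx A -> positive_opmx (map_mx f A).

(* The weak* topology of B(K), as the dual of the trace class operators: it is
   generated by the functionals A |-> \sum_n <A x_n, y_n> where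
   \sum_n |x_n|^2 and \sum_n |y_n|^2 are finite. *)
Definition square_summable K (x : nat -> K) : Prop :=
  cvgn (series (fun n => `|x n| ^+ 2)).

Definition predual_pair K : Type :=
  {p : (nat -> K) * (nat -> K) | square_summable p.1 /\ square_summable p.2}.

Definition predual_form K (p : predual_pair K) (A : 'B(K)) : R[i] :=
  limn (series (fun n => hdot (A ((sval p).1 n)) ((sval p).2 n))).

Definition weak_star K : topologicalType :=
  sup_topology (fun p : predual_pair K =>
    Topological.class (initial_topology (predual_form p))).

Record normal_state K (rho : 'B(K) -> R[i]) : Prop := {
  state_linear : scalar rho ;
  state_ge0 : forall A, positive_op A -> 0 <= rho A ;
  state1 : rho (bop_id K) = 1 ;
  state_normal : continuous (rho : weak_star K -> R[i])
}.

(* Semigroups indexed by t >= 0 are represented by families indexed by R whose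
   values at t < 0 are irrelevant. *)
Record CP_semigroup K (phi : R -> 'B(K) -> 'B(K)) : Prop := {
  cp_linear : forall t : R, 0 <= t -> linear (phi t) ;
  cp_cp : forall t : R, 0 <= t -> completely_positive (phi t) ;
  cp_normal : forall t : R, 0 <= t ->
    continuous (phi t : weak_star K -> weak_star K) ;
  cp_unital : forall t : R, 0 <= t -> phi t (bop_id K) = bop_id K ;
  cp_0 : forall A, phi 0 A = A ;
  cp_add : forall s t : R, 0 <= s -> 0 <= t ->
    forall A, phi (s + t) A = phi s (phi t A) ;
  cp_continuous : forall (A : 'B(K)) (x y : K),
    {within `[0, +oo[, continuous (fun t : R => hdot (phi t A x) y)}
}.

Definition pure K (phi : R -> 'B(K) -> 'B(K)) : Prop :=
  forall rho1 rho2 : 'B(K) -> R[i], normal_state rho1 -> normal_state rho2 ->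
  functional_norm (fun A => rho1 (phi t A) - rho2 (phi t A))
    @[t --> +oo] --> 0%E.

Definition normal_invariant_state K (phi : R -> 'B(K) -> 'B(K))
    (rho : 'B(K) -> R[i]) : Prop :=
  normal_state rho /\ forall t : R, 0 <= t -> forall A, rho (phi t A) = rho A.

Record E0_semigroup H (alpha : R -> 'B(H) -> 'B(H)) : Prop := {
  e0_cp : CP_semigroup alpha ;
  e0_mul : forall t : R, 0 <= t ->
    forall A B, alpha t (A *b B) = alpha t A *b alpha t B
}.

(* A closed subspace K of H is given by the inclusion J : K -> H, an isometry,
   together with its adjoint J' : H -> K. *)
Record subspace_embedding K H (J : bop K H) (J' : bop H K) : Prop := {
  embedding_isometric : forall x y : K, hdot (J x) (J y) = hdot x y ;
  embedding_adjoint : forall (x : K) (y : H), hdot (J x) y = hdot x (J' y)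
}.

(* The orthogonal projection P of H onto K, and the identification of B(K)
   with P B(H) P. *)
Definition subspace_proj K H (J : bop K H) (J' : bop H K) : 'B(H) := J *b J'.

Definition corner K H (J : bop K H) (J' : bop H K) (A : 'B(K)) : 'B(H) :=
  J *b A *b J'.

Definition dilation K H (J : bop K H) (J' : bop H K)
    (phi : R -> 'B(K) -> 'B(K)) (alpha : R -> 'B(H) -> 'B(H)) : Prop :=
  let P := subspace_proj J J' in
  forall t : R, 0 <= t -> forall A : 'B(K),
    corner J J' (phi t A) = P *b alpha t (corner J J' A) *b P.

Definition linear_span (V : lmodType R[i]) (S : set V) : set V :=
  [set x | exists n (c : 'I_n -> R[i]) (v : 'I_n -> V),
    (forall i, S (v i)) /\ x = \sum_(i < n) c i *: v i].

(* The vectors alpha_{t_1}(A_1) ... alpha_{t_n}(A_n) xi with n >= 1, for the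
   list of pairs s = (t_1, A_1), ..., (t_n, A_n). *)
Definition dilation_vectors K H (J : bop K H) (J' : bop H K)
    (alpha : R -> 'B(H) -> 'B(H)) : set H :=
  [set z | exists (s : seq (R * 'B(K))) (x : K),
    [/\ (0 < size s)%N, forall p, p \in s -> 0 <= p.1 &
        z = foldr (fun p y => alpha p.1 (corner J J' p.2) y) (J x) s]].

Definition minimal_dilation K H (J : bop K H) (J' : bop H K)
    (phi : R -> 'B(K) -> 'B(K)) (alpha : R -> 'B(H) -> 'B(H)) : Prop :=
  dilation J J' phi alpha /\
  closure (linear_span (dilation_vectors J J' alpha)) = setT.
End operator_algebra.

(* Main.v *)
From HB Require Import structures.
Require Import Defs.
From mathcomp Require Import all_boot all_order all_algebra.
From mathcomp Require Import all_classical all_reals all_analysis.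
From mathcomp Require Import complex.
From mathcomp Require Import sesquilinear ring.

(** Let [P] be the projection onto [K] and write [compress X] for the compression
    of [X] to [K]. Since [phi] is unital, [alpha t P >= P], hence
    [compress (alpha t X) = phi t (compress X)] for every [X] (lemma
    [compress_alpha]), not only for [X] in the corner.

    Tail. An element [D] of all the ranges is [alpha t (B t)] for each [t], and
    the [B t] are uniformly bounded because the endomorphisms [alpha t] are
    injective and bounded below ([e0_injective], [e0_preimage_bound]). So
    [compress D = phi t (compress (B t))] is the image under [phi t] of a bounded
    family, and purity, applied to pairs of vector states, forces [compress D] to
    be a scalar ([compress_tail]). Subtracting this scalar, let [compress D = 0].
    Then also [compress (X D Y) = 0] for all words [X] and [Y] in letters
    [alpha t C] with [C] in the corner ([compress_word_tail]). The words applied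
    to [K] are total by minimality, so [D = 0] ([tail_compress_eq0]).

    Invariant states. The projections [alpha t P] fix every dilation vector as
    soon as [t] exceeds its first time, so they converge strongly to 1 by
    minimality. A normal state [rho] invariant under [alpha] is constant along
    them; therefore [rho P = 1] ([invariant_state_proj]) and [rho X = rho (P X P)]
    for all [X] ([state_compression]). Consequently the restriction of [rho] to
    the corner is a normal state invariant under [phi]
    ([invariant_state_compression]).

    Adjoints of bounded operators are obtained from the Riesz representation
    theorem ([riesz]). *)

Set Implicit Arguments.
Unset Strict Implicit.
Unset Printing Implicit Defensive.

Import Order.TTheory GRing.Theory Num.Theory.
Import numFieldNormedType.Exports.

Local Open Scope classical_set_scope.
Local Open Scope ring_scope.

(** * Complex numbers and linear functions *)

Section complex_numbers.
Context {R : realType}.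
Implicit Types (z w : R[i]) (r : R).

Lemma ge0_complexE z : 0 <= z -> z = (complex.Re z)%:C%C.
Proof.
by move=> z0; rewrite {1}(complexE z) (ger0_Im z0) rmorph0 mulr0 addr0.
Qed.

Lemma gt0_complexE z : 0 < z -> exists2 r : R, 0 < r & z = r%:C%C.
Proof.
move=> z0; exists (complex.Re z); last exact/ge0_complexE/ltW.
by move: z0; rewrite ltcE => /andP[].
Qed.

Lemma ge0_infimum (T : Type) (S : set T) (q : T -> R[i]) :
  (forall x, 0 <= q x) -> S !=set0 ->
  exists d : R[i], (forall x, S x -> d <= q x) /\
    forall e, 0 < e -> exists2 x, S x & q x < d + e.
Proof.
move=> q0 [x0 Sx0].
pose E := [set complex.Re (q x) | x in S].
have infE : has_inf E.
  split; first by exists (complex.Re (q x0)), x0.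
  by exists 0 => _ [x _ <-]; rewrite -ler0c -ge0_complexE.
exists (inf E)%:C%C; split.
  move=> x Sx; rewrite (ge0_complexE (q0 x)) lecR.
  by apply: ge_inf; [exact: infE.2|exists x].
move=> _ /gt0_complexE[r r0 ->].
have [_ [x Sx <-] xe] := inf_adherent r0 infE.
by exists x => //; rewrite (ge0_complexE (q0 x)) -rmorphD/= ltcR.
Qed.

Lemma norm_ge_Re z : (`|complex.Re z|)%:C%C <= `|z|.
Proof.
rewrite normc_def lecR -sqrtr_sqr ler_wsqrtr//.
by rewrite lerDl sqr_ge0.
Qed.

Lemma norm_ge_Im z : (`|complex.Im z|)%:C%C <= `|z|.
Proof.
rewrite normc_def lecR -sqrtr_sqr ler_wsqrtr//.
by rewrite lerDr sqr_ge0.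
Qed.

Lemma norm_le_Re_Im z :
  `|z| <= (`|complex.Re z|)%:C%C + (`|complex.Im z|)%:C%C.
Proof.
have nR r : `|r%:C%C : R[i]| = `|r|%:C%C.
  by rewrite normc_def/= expr0n addr0 sqrtr_sqr.
rewrite {1}(complexE z); apply: le_trans (ler_normD _ _) _.
rewrite normrM !nR; have -> : `|'i%C : R[i]| = 1 by exact: normCi.
by rewrite mul1r.
Qed.

(** The real and imaginary parts are Lipschitz, so they transport Cauchy filters
    to [R], where they converge. *)
Lemma complex_cauchy_cvg (F : set_system R[i]) : ProperFilter F ->
  cauchy F -> cvg F.
Proof.
move=> FF /cauchyP cF.
have cvgRI (f : R[i] -> R) : (forall z w, (`|f z - f w|)%:C%C <= `|z - w|) ->
    exists a : R, f @ F --> a.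
  move=> f_lip; suff /cvg_ex[a fa] : cvg (f @ F) by exists a.
  apply: cauchy_cvg; apply: cauchy_exP => e e0.
  have [z Fz] := cF e%:C%C (eq_ind_r is_true e0 (ltcR _ _)).
  exists (f z); rewrite -[(f @ F) _]/(F (f @^-1` ball (f z) e)).
  apply: filterS Fz => w zw; rewrite /= -ball_normE/= -ltcR.
  apply: le_lt_trans (f_lip _ _) _.
  by move: zw; rewrite -ball_normE.
have [a Fa] : exists a : R, @complex.Re R @ F --> a.
  by apply: cvgRI => z w; apply: le_trans (norm_ge_Re (z - w)); rewrite raddfB.
have [b Fb] : exists b : R, @complex.Im R @ F --> b.
  by apply: cvgRI => z w; apply: le_trans (norm_ge_Im (z - w)); rewrite raddfB.
apply/cvg_ex; exists (Complex a b).
apply/cvgrPdist_lt => e /gt0_complexE[r r0 ->].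
have r20 : 0 < r / 2 by rewrite divr_gt0.
move/cvgrPdist_lt : Fa => /(_ _ r20); move/cvgrPdist_lt : Fb => /(_ _ r20).
apply: filterS2 => w wb wa; apply: le_lt_trans (norm_le_Re_Im _) _.
by rewrite -rmorphD/= ltcR !raddfB/= [ltRHS]splitr ltrD.
Qed.

Lemma complex_dominated_series (a b : nat -> R[i]) :
  (forall k, `|a k| <= b k) -> cvgn (series b) -> cvgn (series a).
Proof.
move=> ab /cvg_cauchy/cauchy_seriesP cb.
apply: complex_cauchy_cvg; apply/cauchy_seriesP => e e0.
have := cb e e0; apply: filterS => -[m n] /=; apply: le_lt_trans.
apply: le_trans (ler_norm_sum _ _ _) _.
have b0 k : 0 <= b k by exact: le_trans (ab k).
by rewrite (ger0_norm (sumr_ge0 _ _))//; exact: ler_sum.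
Qed.

Lemma norm_lim_le (u : nat -> R[i]) (l : R[i]) (e : R[i]) :
  u @ \oo --> l -> (\forall n \near \oo, `|u n| <= e) -> `|l| <= e.
Proof.
move=> /cvgrPdist_lt ul ue.
have [N _ uN] := ue; have e_ge0 : 0 <= e := le_trans (normr_ge0 _) (uN N (leqnn N)).
apply: contraT; rewrite -real_ltNge ?normr_real ?ger0_real// => le.
have d0 : 0 < `|l| - e by rewrite subr_gt0.
have [n [lun une]] : exists n, `|l - u n| < `|l| - e /\ `|u n| <= e.
  have := filterI (ul _ d0) ue => -[m _ mP]; exists m.
  by have := mP m (leqnn m).
have : `|l| < `|l|.
  rewrite -{1}(subrK (u n) l); apply: le_lt_trans (ler_normD _ _) _.
  by rewrite -(subrK e `|l|) ltr_leD.
by rewrite ltxx.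
Qed.

(** A nonconstant affine function takes negative values. *)
Lemma affine_ge0_real (c s : R[i]) :
  (forall t, t \is Num.real -> 0 <= c + t * s) -> s = 0.
Proof.
move=> h; have c0 : 0 <= c by have := h 0 (rpred0 _); rewrite mul0r addr0.
have sr : s \is Num.real.
  have := ger0_real (h 1 (rpred1 _)); rewrite mul1r => /rpredB/(_ (ger0_real c0)).
  by rewrite addrC addKr.
apply/eqP; apply: contraT => s0.
have tr : - (c + 1) / s \is Num.real.
  by rewrite realM ?realV// realN realD// ger0_real.
by have := h _ tr; rewrite divfK// opprD addrA subrr add0r oppr_ge0 ler10.
Qed.

(** Real and purely imaginary [z] give [a + b = 0] and [a - b = 0]. *)
Lemma affine_ge0_complex (c a b : R[i]) :
  (forall z, 0 <= c + (z * a + z^* * b)) -> a = 0 /\ b = 0.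
Proof.
move=> h.
have ab : a + b = 0.
  apply: (@affine_ge0_real c) => t /CrealP tr.
  by have := h t; rewrite tr mulrDr.
have : 'i * (a - b) = 0.
  apply: (@affine_ge0_real c) => t /CrealP tr.
  have := h (t * 'i); rewrite rmorphM/= tr conjCi.
  by have -> : t * 'i * a + t * - 'i * b = t * ('i * (a - b)) by ring.
move/eqP; rewrite mulf_eq0 (negPf (neq0Ci _))/= subr_eq0 => /eqP eab.
rewrite eab; suff : b = 0 by [].
by move: ab; rewrite eab -mulr2n -mulr_natl => /eqP; rewrite mulf_eq0 pnatr_eq0 => /eqP.
Qed.
End complex_numbers.

(** Rules for maps whose linearity is a hypothesis rather than a structure. *)
Section linear_functions.
Context {C : pzRingType} {U V : lmodType C} {f : U -> V}.
Hypothesis lf : linear f.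

Lemma linear_funD x y : f (x + y) = f x + f y.
Proof. by have := lf 1 x y; rewrite !scale1r. Qed.

Lemma linear_fun0 : f 0 = 0.
Proof. by apply: (addrI (f 0)); rewrite -linear_funD !addr0. Qed.

Lemma linear_funZ c x : f (c *: x) = c *: f x.
Proof. by have := lf c x 0; rewrite linear_fun0 !addr0. Qed.

Lemma linear_funB x y : f (x - y) = f x - f y.
Proof. by rewrite linear_funD -scaleN1r linear_funZ scaleN1r. Qed.

Lemma linear_fun_sum n (x : 'I_n -> U) :
  f (\sum_(i < n) x i) = \sum_(i < n) f (x i).
Proof.
by elim/big_ind2 : _ => [|u v u' v' <- <-|//]; rewrite ?linear_fun0 ?linear_funD.
Qed.
End linear_functions.

(** * Hilbert spaces and bounded operators *)

Section hilbert_space.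
Context {R : realType}.
Implicit Types V : hilbertType R.

Lemma hdotDl V (x y z : V) : hdot (x + y) z = hdot x z + hdot y z.
Proof. exact: linearDl. Qed.

Lemma hdotDr V (z x y : V) : hdot z (x + y) = hdot z x + hdot z y.
Proof. exact: linearDr. Qed.

Lemma hdotBl V (x y z : V) : hdot (x - y) z = hdot x z - hdot y z.
Proof. exact: linearBl. Qed.

Lemma hdotBr V (z x y : V) : hdot z (x - y) = hdot z x - hdot z y.
Proof. exact: linearBr. Qed.

Lemma hdotNl V (x z : V) : hdot (- x) z = - hdot x z.
Proof. exact: linearNl. Qed.

Lemma hdotNr V (z x : V) : hdot z (- x) = - hdot z x.
Proof. exact: linearNr. Qed.

Lemma hdotZl V (a : R[i]) (x z : V) : hdot (a *: x) z = a * hdot x z.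
Proof. exact: linearZl_LR. Qed.

Lemma hdotZr V (a : R[i]) (z x : V) : hdot z (a *: x) = a^* * hdot z x.
Proof. exact: linearZr_LR. Qed.

Lemma hdot0l V (z : V) : hdot 0 z = 0.
Proof. exact: linear0l. Qed.

Lemma hdot0r V (z : V) : hdot z 0 = 0.
Proof. exact: linear0r. Qed.

Lemma hdotC V (x y : V) : hdot x y = (hdot y x)^*.
Proof. by rewrite (hermC hdot x y) expr0 mul1r. Qed.

Lemma hdot_ge0 V (x : V) : 0 <= hdot x x.
Proof. exact: dnorm_ge0. Qed.

Lemma hdot_eq0 V (x : V) : (hdot x x == 0) = (x == 0).
Proof. exact: dnorm_eq0. Qed.

Lemma hdot_eq0P V (u : V) : (forall v, hdot u v = 0) -> u = 0.
Proof. by move=> u0; apply/eqP; rewrite -hdot_eq0 u0. Qed.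

Lemma hdot_norm V (x : V) : hdot x x = `|x| ^+ 2.
Proof. by rewrite hnormE. Qed.

(** The vector on the left is the component of [x] orthogonal to [y]. The
    identity yields Cauchy-Schwarz, and also the orthogonality of a vector of
    minimal norm in an affine hyperplane. *)
Lemma norm_sub_line V (x y : V) : y != 0 ->
  `|x - (hdot x y / `|y| ^+ 2) *: y| ^+ 2
  = `|x| ^+ 2 - `|hdot x y| ^+ 2 / `|y| ^+ 2.
Proof.
move=> y0; have n0 : `|y| ^+ 2 != 0 by rewrite expf_neq0 ?normr_eq0.
rewrite -hdot_norm hdotBl !hdotBr !hdotZl !hdotZr -!hdot_norm (hdotC y x).
rewrite -hdot_norm in n0.
have -> : (hdot x y / hdot y y)^* = (hdot x y)^* / hdot y y.
  by rewrite rmorphM/= fmorphV/= (CrealP (ger0_real (hdot_ge0 y))).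
rewrite normCK; set a := hdot x y; set b := a^*; set c := hdot y y in n0 *.
by field.
Qed.

Lemma cauchy_schwarz V (x y : V) : `|hdot x y| <= `|x| * `|y|.
Proof.
have [->|y0] := eqVneq y 0; first by rewrite hdot0r !normr0 mulr0.
rewrite -(@ler_pXn2r _ 2) ?nnegrE ?mulr_ge0// exprMn.
rewrite -ler_pdivrMr ?exprn_gt0 ?normr_gt0// -subr_ge0.
by rewrite -norm_sub_line// exprn_ge0.
Qed.

Lemma parallelogram V (x y : V) :
  `|x - y| ^+ 2 = 2 * `|x| ^+ 2 + 2 * `|y| ^+ 2 - `|x + y| ^+ 2.
Proof. by rewrite -!hdot_norm hdotBl !hdotBr hdotDl !hdotDr; ring. Qed.

Lemma bopP V W (A : bop V W) : linear A /\ continuous A.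
Proof. exact/bounded_opP/(valP A). Qed.
End hilbert_space.

Section bounded_linear.
Context {R : realType}.
Implicit Types U V W : hilbertType R.

HB.instance Definition _ V W (A : bop V W) :=
  GRing.isLinear.Build R[i] V W _ (bop_fun A) (bopP A).1.

Lemma bop_ext V W (A B : bop V W) : (forall x, A x = B x) -> A = B.
Proof. by move=> AB; apply: val_inj; apply/funext. Qed.

Lemma bopD V W (A : bop V W) x y : A (x + y) = A x + A y.
Proof. exact: linearD. Qed.

Lemma bopB V W (A : bop V W) x y : A (x - y) = A x - A y.
Proof. exact: linearB. Qed.

Lemma bopZ V W (A : bop V W) (c : R[i]) x : A (c *: x) = c *: A x.
Proof. exact: linearZ_LR. Qed.

Lemma bop0 V W (A : bop V W) : A 0 = 0.
Proof. exact: linear0. Qed.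

Lemma bop_continuous V W (A : bop V W) : continuous A.
Proof. exact: (bopP A).2. Qed.

Lemma bop_bounded V W (A : bop V W) :
  exists2 M : R[i], 0 < M & forall x, `|A x| <= M * `|x|.
Proof.
have /linear_bounded_continuous/linear_boundedP/pinfty_ex_gt0[M M0 AM] :=
  @bop_continuous _ _ A.
by exists M.
Qed.

Lemma bounded_linear_bop V W (f : V -> W) (M : R[i]) :
  linear f -> (forall x, `|f x| <= M * `|x|) ->
  exists A : bop V W, forall x, A x = f x.
Proof.
move=> lf fM; pose g : {linear V -> W} := HB.pack f
  (GRing.isLinear.Build R[i] V W _ f lf).
suff h : f \in @bounded_op R[i] V W by exists (Bop h).
apply/bounded_opP; split => //.
apply: (@bounded_linear_continuous _ _ _ g).
apply/bounded_funP => r; exists (`|M| * r) => x xr /=.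
apply: le_trans (fM x) _; apply: le_trans (_ : `|M| * `|x| <= _); last first.
  by rewrite ler_wpM2l.
have M0 : 0 <= M * `|x| by exact: le_trans (fM x).
by rewrite -(ger0_norm M0) normrM normr_id.
Qed.

Lemma bop_addE V W (A B : bop V W) x : (A + B) x = A x + B x.
Proof. by []. Qed.

Lemma bop_subE V W (A B : bop V W) x : (A - B) x = A x - B x.
Proof. by []. Qed.

Lemma bop_scaleE V W (c : R[i]) (A : bop V W) x : (c *: A) x = c *: A x.
Proof. by []. Qed.

Lemma bop_compE U V W (A : bop V W) (B : bop U V) x : (A *b B) x = A (B x).
Proof. by []. Qed.

Lemma bop_idE V (x : V) : bop_id V x = x.
Proof. by []. Qed.

Lemma hdot_continuous V (x : V) : continuous (fun y : V => hdot y x).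
Proof.
have l : linear (fun y : V => hdot y x : R[i]^o).
  by move=> a u v; rewrite hdotDl hdotZl.
pose g : {linear V -> R[i]^o} := HB.pack (fun y : V => hdot y x : R[i]^o)
  (GRing.isLinear.Build R[i] V R[i]^o _ _ l).
apply: (@bounded_linear_continuous _ _ _ g).
apply/bounded_funP => r; exists (r * `|x|) => y yr /=.
by apply: le_trans (cauchy_schwarz y x) _; rewrite ler_wpM2r.
Qed.

(** A nonzero [f] is represented by a multiple of the vector [z] of minimal norm
    in the hyperplane [f = 1]. The almost minimal vectors of this hyperplane form
    a Cauchy filter by the parallelogram law, and its limit is [z]. *)
Lemma riesz V (f : V -> R[i]^o) : linear f -> continuous f ->
  exists z, forall x, f x = hdot x z.
Proof.
move=> lf cf; have [f0|/existsNP[y0 fy0]] := pselect (forall x, f x = 0).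
  by exists 0 => x; rewrite f0 hdot0r.
pose S := [set x | f x = 1].
have S0 : S !=set0.
  exists ((f y0)^-1 *: y0); rewrite /S/= (linear_funZ lf).
  by rewrite -[_ *: _]/(_ * _) mulVf//; exact/eqP.
have [d [dS dlt]] := @ge0_infimum _ _ S (fun x => `|x| ^+ 2)
  (fun x => exprn_ge0 2 (normr_ge0 x)) S0.
have mid (x1 x2 : V) : S x1 -> S x2 -> 4 * d <= `|x1 + x2| ^+ 2.
  move=> S1 S2; have /dS : S (2^-1 *: (x1 + x2)).
    rewrite /S/= (linear_funZ lf) (linear_funD lf) S1 S2.
    by rewrite -[_ *: _]/(_ * _); field.
  rewrite normrZ exprMn normrV ?unitfE ?pnatr_eq0// normr_nat.
  rewrite -(ler_pM2l (_ : 0 < 4)) ?ltr0n//.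
  by move=> /le_trans; apply; rewrite le_eqVlt; apply/orP; left; apply/eqP; field.
pose B (e : R[i]) := [set x | S x /\ `|x| ^+ 2 < d + e].
pose F := filter_from [set e : R[i] | 0 < e] B.
have FF : ProperFilter F.
  apply: filter_from_proper; last by move=> e /dlt[x Sx xe]; exists x.
  apply: filter_from_filter; first by exists 1; rewrite /= ltr01.
  move=> e1 e2 /= e10 e20; have [le12|/ltW le21] := real_leP (gtr0_real e10) (gtr0_real e20).
    exists e1 => // x [Sx xe]; split; split => //.
    by apply: lt_le_trans xe _; rewrite lerD2l.
  exists e2 => // x [Sx xe]; split; split => //.
  by apply: lt_le_trans xe _; rewrite lerD2l.
have /cauchy_cvg : cauchy F.
  apply: cauchy_exP => e e0.
  have e20 : 0 < e ^+ 2 / 4 by rewrite divr_gt0 ?exprn_gt0.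
  have [x Sx xe] := dlt _ e20.
  exists x, (e ^+ 2 / 4) => //= y [Sy ye].
  rewrite -ball_normE /ball_/= -(@ltr_pXn2r _ 2) ?nnegrE ?(ltW e0)//.
  rewrite parallelogram; have := mid _ _ Sx Sy.
  rewrite -lerN2 => h; apply: le_lt_trans (lerD (lexx _) h) _.
  have -> : e ^+ 2 = 2 * (d + e ^+ 2 / 4) + 2 * (d + e ^+ 2 / 4) - 4 * d.
    by field.
  by rewrite ltrD2r ltrD// ltr_pM2l.
move=> /cvg_ex[z Fz].
have fz : f z = 1.
  have /cvg_unique : f @ F --> f z by apply: continuous_cvg => //; exact: cf.
  apply => //; apply: cvg_near_cst; exists 1 => /=; first exact: ltr01.
  by move=> x [].
(* Every almost minimal x is almost orthogonal to k, because subtracting from x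
   its projection onto the line of k stays in the hyperplane. *)
have zk (k : V) : f k = 0 -> hdot z k = 0.
  move=> fk; have [->|k0] := eqVneq k 0; first by rewrite hdot0r.
  have nk0 : 0 < `|k| ^+ 2 by rewrite exprn_gt0 ?normr_gt0.
  apply: (@cvg_unique _ _ ((fun x => hdot x k : R[i]^o) @ F)).
  - exact: norm_hausdorff.
  - apply: (cvg_trans (cvg_app _ Fz)); exact: hdot_continuous.
  apply/cvgr0Pnorm_lt => e e0; exists (e ^+ 2 / `|k| ^+ 2) => /=.
    by rewrite divr_gt0// exprn_gt0.
  move=> x [Sx xe] /=; rewrite -(@ltr_pXn2r _ 2) ?nnegrE ?(ltW e0)//.
  have : d <= `|x - (hdot x k / `|k| ^+ 2) *: k| ^+ 2.
    by apply: dS; rewrite /S/= (linear_funB lf) (linear_funZ lf) fk scaler0 subr0.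
  rewrite norm_sub_line// lerBrDr addrC -lerBrDr => h.
  rewrite -(@ltr_pM2r _ (`|k| ^+ 2)^-1) ?invr_gt0//.
  by apply: le_lt_trans h _; rewrite ltrBlDl.
have z0 : z != 0.
  apply/eqP => z0; have /eqP := linear_fun0 lf.
  by rewrite -z0 fz oner_eq0.
have nz0 : hdot z z != 0 by rewrite hdot_eq0.
exists ((hdot z z)^-1 *: z) => x.
rewrite hdotZr fmorphV/= (CrealP (ger0_real (hdot_ge0 z))).
have /zk : f (x - f x *: z) = 0.
  rewrite (linear_funB lf) (linear_funZ lf) fz.
  by rewrite -[_ *: 1]/(_ * _) mulr1 subrr.
rewrite hdotC => /eqP; rewrite conjC_eq0 hdotBl hdotZl subr_eq0 => /eqP ->.
by rewrite mulrC mulfK.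
Qed.

Lemma adjoint_ex V W (A : bop V W) :
  exists B : bop W V, forall x y, hdot (A x) y = hdot x (B y).
Proof.
have [M M0 AM] := bop_bounded A.
have /choice[B AB] y : exists z, forall x, hdot (A x) y = hdot x z.
  apply: (@riesz V (fun x => hdot (A x) y)).
    by move=> a u v; rewrite linearP hdotDl hdotZl.
  move=> x; apply: (@continuous_comp _ _ _ A (fun w => hdot w y)).
    exact: bop_continuous.
  exact: hdot_continuous.
have linB : linear B.
  move=> a u v; apply/eqP; rewrite -subr_eq0 -hdot_eq0; set w := _ - _.
  by rewrite {2}/w hdotBr hdotDr hdotZr -!AB hdotDr hdotZr subrr.
have [y|C CB] := @bounded_linear_bop _ _ B M linB; last first.
  by exists C => x y; rewrite CB AB.
have [->|By0] := eqVneq (B y) 0.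
  by rewrite normr0 mulr_ge0// ltW.
rewrite -(@ler_pM2r _ `|B y|) ?normr_gt0//.
have -> : `|B y| * `|B y| = `|hdot (A (B y)) y|.
  by rewrite AB hdot_norm normrX normr_id expr2.
apply: le_trans (cauchy_schwarz _ _) _.
by rewrite mulrAC ler_wpM2r.
Qed.
End bounded_linear.

(** * Positive operators and positive maps *)

Section positive_operators.
Context {R : realType}.
Implicit Types V : hilbertType R.

Lemma polarization V (T : 'B(V)) (x y : V) :
  4 * hdot (T x) y = hdot (T (x + y)) (x + y) - hdot (T (x - y)) (x - y)
    + 'i * hdot (T (x + 'i *: y)) (x + 'i *: y)
    - 'i * hdot (T (x - 'i *: y)) (x - 'i *: y).
Proof.
rewrite !(bopB, bopD, bopZ).
rewrite !(hdotDl, hdotNl, hdotDr, hdotNr, hdotZl, hdotZr) conjCi.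
have i2 : ('i : R[i]) * 'i = -1 by rewrite -expr2 sqrCi.
ring: i2.
Qed.

Lemma quadratic_form_eq0 V (T : 'B(V)) :
  (forall x, hdot (T x) x = 0) -> T = 0.
Proof.
move=> T0; apply: bop_ext => x; apply: hdot_eq0P => y.
apply/eqP; rewrite -(mulrI_eq0 _ (_ : GRing.lreg (4 : R[i]))); last first.
  by apply/lregP; rewrite pnatr_eq0.
by rewrite polarization !T0 !mulr0 !subr0 addr0.
Qed.

(** By polarization. That the factor is uniform is all that the comparison of [A]
    with its image under an endomorphism requires. *)
Lemma numerical_radius_norm V (T : 'B(V)) (M : R[i]) :
  (forall x, `|hdot (T x) x| <= M * `|x| ^+ 2) ->
  forall x, `|T x| <= 2 * M * `|x|.
Proof.
move=> TM x.
have [->|x0] := eqVneq x 0; first by rewrite bop0 !normr0 mulr0.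
have nx0 : 0 < `|x| by rewrite normr_gt0.
have M0 : 0 <= M.
  rewrite -(@pmulr_lge0 _ (`|x| ^+ 2)) ?exprn_gt0//.
  exact: le_trans (TM x).
have [->|Tx0] := eqVneq (T x) 0; first by rewrite normr0 !mulr_ge0// ler0n.
have nTx0 : 0 < `|T x| by rewrite normr_gt0.
have bnd y : `|hdot (T x) y| <= M * (`|x| ^+ 2 + `|y| ^+ 2).
  rewrite -(@ler_pM2l _ 4) ?ltr0n// -{1}(@normr_nat R[i] 4) -normrM polarization.
  have ni : `|'i : R[i]| = 1 by exact: normCi.
  have par z : `|x + z| ^+ 2 + `|x - z| ^+ 2 = 2 * (`|x| ^+ 2 + `|z| ^+ 2).
    by rewrite parallelogram; ring.
  apply: le_trans (ler_normD _ _) _; rewrite normrN.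
  apply: le_trans (lerD (ler_normD _ _) (lexx _)) _.
  apply: le_trans (lerD (lerD (ler_normB _ _) (lexx _)) (lexx _)) _.
  rewrite !normrM ni !mul1r.
  apply: le_trans (lerD (lerD (lerD (TM _) (TM _)) (TM _)) (TM _)) _.
  rewrite -!mulrDr -!addrA par addrA par normrZ ni mul1r.
  by rewrite le_eqVlt; apply/orP; left; apply/eqP; ring.
(* This multiple of T x has the norm of x. *)
have := bnd ((`|x| / `|T x|) *: T x).
have -> : `|(`|x| / `|T x|) *: T x| = `|x|.
  by rewrite normrZ normrM normrV ?unitfE ?gt_eqF// !normr_id divfK ?gt_eqF.
rewrite hdotZr hdot_norm normrM norm_conjC normrX normr_id.
rewrite normrM normrV ?unitfE ?gt_eqF// !normr_id expr2 mulrA.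
rewrite divfK ?gt_eqF// mulrC => h; rewrite -(ler_pM2r nx0).
by apply: le_trans h _; rewrite le_eqVlt; apply/orP; left; apply/eqP; ring.
Qed.

Definition adjoint_op V (A B : 'B(V)) := forall x y, hdot (A x) y = hdot x (B y).

Lemma adjoint_op_sym V (A B : 'B(V)) : adjoint_op A B -> adjoint_op B A.
Proof. by move=> AB x y; rewrite hdotC -AB -hdotC. Qed.

Lemma adjoint_op_comp V (A A' B B' : 'B(V)) :
  adjoint_op A A' -> adjoint_op B B' -> adjoint_op (A *b B) (B' *b A').
Proof. by move=> AA BB x y; rewrite !bop_compE AA BB. Qed.

(** The forms of [T] and of its adjoint agree on the diagonal, where they are
    real. *)
Lemma positive_op_self_adjoint V (T : 'B(V)) : positive_op T -> adjoint_op T T.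
Proof.
move=> T0; have [S TS] := adjoint_ex T.
suff ST : S = T by move=> x y; rewrite TS ST.
apply/eqP; rewrite -subr_eq0; apply/eqP; apply: quadratic_form_eq0 => x.
rewrite bop_subE hdotBl (hdotC (S x)) -TS.
by rewrite (CrealP (ger0_real (T0 x))) subrr.
Qed.

Record positive_unital V (f : 'B(V) -> 'B(V)) : Prop := {
  pu_linear : linear f ;
  pu_positive : forall A, positive_op A -> positive_op (f A) ;
  pu_unital : f (bop_id V) = bop_id V
}.

(** Adding a large multiple of the identity to [S] makes it positive, and positive
    operators are self-adjoint. *)
Lemma positive_unital_self_adjoint V (f : 'B(V) -> 'B(V)) (S : 'B(V)) :
  positive_unital f -> adjoint_op S S -> adjoint_op (f S) (f S).
Proof.
move=> [lf pf uf] SS; have [M M0 SM] := bop_bounded S.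
have Mr : M^* = M by exact/CrealP/gtr0_real.
have : positive_op (M *: bop_id V + S).
  move=> x; rewrite bop_addE bop_scaleE /= hdotDl hdotZl hdot_norm.
  have rS : hdot (S x) x \is Num.real by apply/CrealP; rewrite -hdotC SS.
  rewrite addrC -lerBlDr sub0r.
  have /real_ler_normlP : `|hdot (S x) x| <= M * `|x| ^+ 2.
    apply: le_trans (cauchy_schwarz _ _) _.
    by rewrite expr2 mulrA ler_wpM2r.
  by move=> /(_ rS)[h _]; rewrite lerNl.
move/pf/positive_op_self_adjoint => h x y; have := h x y.
rewrite lf uf !bop_addE !bop_scaleE /= hdotDl hdotDr hdotZl hdotZr Mr.
exact: addrI.
Qed.

Lemma positive_unital_adjoint V (f : 'B(V) -> 'B(V)) (A B : 'B(V)) :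
  positive_unital f -> adjoint_op A B -> adjoint_op (f A) (f B).
Proof.
move=> pf AB x y; have BA := adjoint_op_sym AB.
have lf := pu_linear pf.
(* A + B and 'i (A - B) are self-adjoint, and they determine A and B. *)
have := @positive_unital_self_adjoint _ f (A + B) pf.
move=> /(_ _ x y); rewrite (linear_funD lf) !bop_addE hdotDl hdotDr => h1.
have := @positive_unital_self_adjoint _ f ('i *: (A + (-1) *: B)) pf.
move=> /(_ _ x y).
rewrite (linear_funZ lf) (linear_funD lf) (linear_funZ lf).
rewrite !(bop_scaleE, bop_addE, hdotZl, hdotZr, hdotDl, hdotDr).
rewrite conjCi rmorphN rmorph1 => h2.
have {h1} e1 : hdot (f A x) y + hdot (f B x) y
   = hdot x (f A y) + hdot x (f B y).
  by apply: h1 => u v; rewrite !bop_addE hdotDl hdotDr AB BA addrC.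
have {h2} e2 : hdot (f A x) y - hdot (f B x) y
   = - hdot x (f A y) + hdot x (f B y).
  have /h2 : adjoint_op ('i *: (A + (-1) *: B)) ('i *: (A + (-1) *: B)).
    move=> u v; rewrite !(bop_scaleE, bop_addE, hdotZl, hdotZr, hdotDl, hdotDr).
    by rewrite conjCi rmorphN rmorph1 AB BA; ring.
  have i0 : ('i : R[i]) != 0 by exact: neq0Ci.
  by move=> h; apply: (mulfI i0); rewrite mulrDr; move: h; rewrite !mulN1r !mulrDr => ->; ring.
apply: (mulfI (_ : (2 : R[i]) != 0)); first by rewrite pnatr_eq0.
transitivity ((hdot (f A x) y + hdot (f B x) y) + (hdot (f A x) y - hdot (f B x) y)); first by ring.
by rewrite e1 e2; ring.
Qed.

(** Complete positivity for matrices of size one. *)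
Lemma completely_positive_positive V (f : 'B(V) -> 'B(V)) :
  completely_positive f -> forall A, positive_op A -> positive_op (f A).
Proof.
move=> cf A A0 x; have := cf 1%N (const_mx A).
have h (B : 'B(V)) (y : 'I_1 -> V) : \sum_(i < 1) \sum_(j < 1)
    hdot ((const_mx B : 'M['B(V)]_1) i j (y j)) (y i) = hdot (B (y ord0)) (y ord0).
  by rewrite !big_ord1 mxE.
move=> /(_ _ (fun=> x)); rewrite map_const_mx h; apply => y.
by rewrite h.
Qed.

Lemma cp_positive_unital V (phi : R -> 'B(V) -> 'B(V)) (t : R) :
  CP_semigroup phi -> 0 <= t -> positive_unital (phi t).
Proof.
move=> cp t0; split; [exact: cp_linear|
  exact/completely_positive_positive/cp_cp|exact: cp_unital].
Qed.

(** Such an [e] is self-adjoint, hence [|e x|^2] is the inner product of [x] and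
    [e x]. *)
Lemma projection_norm V (e : 'B(V)) : positive_op e -> e *b e = e ->
  forall x, `|e x| <= `|x|.
Proof.
move=> e0 ee x; have ea := positive_op_self_adjoint e0.
have eex : e (e x) = e x by rewrite -bop_compE ee.
have [->|ex0] := eqVneq (e x) 0; first by rewrite normr0.
rewrite -(@ler_pM2r _ `|e x|) ?normr_gt0//.
have -> : `|e x| * `|e x| = `|hdot x (e x)|.
  by rewrite -[in RHS]eex -ea hdot_norm normrX normr_id expr2.
exact: cauchy_schwarz.
Qed.
End positive_operators.

(** * Endomorphism semigroups are injective and bounded below *)

Section injectivity.
Context {R : realType}.
Implicit Types V : hilbertType R.

Lemma rank_one_ex V (x y : V) : exists E : 'B(V), forall v, E v = hdot v y *: x.
Proof.
apply: (@bounded_linear_bop _ _ _ _ (`|y| * `|x|)).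
  by move=> a u v; rewrite hdotDl hdotZl scalerDl scalerA.
move=> v; rewrite normrZ.
apply: le_trans (ler_wpM2r (normr_ge0 _) (cauchy_schwarz _ _)) _.
by rewrite le_eqVlt; apply/orP; left; apply/eqP; ring.
Qed.

(** By continuity at 0 of the matrix coefficient of [phi t E] at [x]. *)
Lemma cp_small_neq0 V (phi : R -> 'B(V) -> 'B(V)) (E : 'B(V)) (x : V) :
  CP_semigroup phi -> hdot (E x) x != 0 ->
  exists2 d : R, 0 < d & forall t, 0 <= t -> t < d -> phi t E <> 0.
Proof.
move=> cp Ex0; have /subspace_continuousP/(_ 0) := @cp_continuous _ _ _ cp E x x.
rewrite /= in_itv /= lexx => /(_ isT).
move=> /cvgrPdist_lt/(_ `|hdot (E x) x|); rewrite normr_gt0 => /(_ Ex0).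
rewrite /from_subspace (cp_0 cp) => /nbhs_ballP[d /= d0 dball]; exists d => // t t0 td pE0.
have := dball t; rewrite /ball/= sub0r normrN ger0_norm// in_itv/= t0.
by move=> /(_ td isT); rewrite pE0 hdot0l subr0 ltxx.
Qed.

Variables (V : hilbertType R) (alpha : R -> 'B(V) -> 'B(V)).
Hypothesis e0 : E0_semigroup alpha.
Let cp := e0_cp e0.

Lemma e0_iter_eq0 t n A : 0 <= t -> (forall B, alpha t B = 0 -> B = 0) ->
  alpha (t *+ n) A = 0 -> A = 0.
Proof.
move=> t0 inj; elim: n A => [|n IHn] A; first by rewrite mulr0n (cp_0 cp).
rewrite mulrS cp_add ?mulrn_wge0//.
by move=> /inj/IHn.
Qed.

(** The kernel of [alpha t] is a two-sided ideal, so if it is not zero then it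
    contains the rank one operators. This is impossible for small [t] by
    continuity, and [alpha t] is a power of [alpha (t / n)]. *)
Lemma e0_injective t A : 0 <= t -> alpha t A = 0 -> A = 0.
Proof.
move=> t0 tA; apply: bop_ext => x; apply/eqP; apply: contraT => Ax0.
have [E EE] := rank_one_ex (A x) (A x).
have [F FE] := rank_one_ex x (A x).
have [d d0 dE] : exists2 d : R, 0 < d & forall t, 0 <= t -> t < d ->
    alpha t E <> 0.
  apply: (@cp_small_neq0 _ _ E (A x) cp).
  by rewrite EE hdotZl mulf_neq0// hdot_eq0.
have EAF : A *b F = E by apply: bop_ext => v; rewrite bop_compE FE bopZ EE.
pose n := (Num.trunc (t / d)).+1.
have n0 : 0 < (n%:R : R) by rewrite ltr0n.
have ntd : t / n%:R < d.
  rewrite ltr_pdivrMr// mulrC -ltr_pdivrMr//.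
  exact: truncnS_gt.
have tn0 : 0 <= t / n%:R by rewrite divr_ge0// ltW.
suff A0 : A = 0 by move: Ax0; rewrite A0 eqxx.
apply: (@e0_iter_eq0 (t / n%:R) n) => //; last first.
  by rewrite -(mulr_natr (t / n%:R)) divfK ?gt_eqF.
(* G *b B *b H is a nonzero multiple of E, which survives under alpha. *)
move=> B B0; apply: bop_ext => y; apply/eqP; apply: contraT => By0.
have [G GE] := rank_one_ex (A x) (B y).
have [H HE] := rank_one_ex y (A x).
exfalso; apply: (dE _ tn0 ntd).
have : alpha (t / n%:R) (G *b B *b H) = 0.
  rewrite !(e0_mul e0)// B0; apply: bop_ext => v.
  by rewrite !bop_compE [X in alpha _ G X]/= bop0.
have -> : G *b B *b H = hdot (B y) (B y) *: E.
  apply: bop_ext => v.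
  rewrite !bop_compE HE bopZ bopZ GE bop_scaleE EE !scalerA mulrC.
  by [].
rewrite (linear_funZ (cp_linear cp tn0)) => /eqP; rewrite scaler_eq0 hdot_eq0 (negPf By0) /=.
by move/eqP.
Qed.

Lemma e0_inj t A B : 0 <= t -> alpha t A = alpha t B -> A = B.
Proof.
move=> t0 AB; apply/eqP; rewrite -subr_eq0; apply/eqP.
by apply: (@e0_injective t) => //; rewrite (linear_funB (cp_linear cp t0)) AB subrr.
Qed.

Lemma e0_positive_unital t : 0 <= t -> positive_unital (alpha t).
Proof. exact: cp_positive_unital. Qed.

(** If [E] is the orthogonal projection onto the line of [x], then [E A E] is [E]
    times the diagonal coefficient of [A] at [x]. Applying [alpha t], this
    coefficient is read off on a vector fixed by the nonzero projection
    [alpha t E]. *)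
Lemma e0_numerical_radius t A M : 0 <= t ->
  (forall v, `|alpha t A v| <= M * `|v|) ->
  forall x, `|hdot (A x) x| <= M * `|x| ^+ 2.
Proof.
move=> t0 AM x.
have [->|x0] := eqVneq x 0; first by rewrite hdot0r !normr0 expr0n mulr0.
have hx0 : hdot x x != 0 by rewrite hdot_eq0.
have [E EE] := rank_one_ex ((hdot x x)^-1 *: x) x.
have E0 : positive_op E.
  move=> v; rewrite EE !hdotZl (hdotC x v) mulrCA -normCK mulr_ge0 ?exprn_ge0//.
  by rewrite invr_ge0 hdot_ge0.
have Ex : E x = x by rewrite EE scalerA mulfV// scale1r.
have EEE : E *b E = E.
  by apply: bop_ext => v; rewrite bop_compE [E v]EE !bopZ Ex.
have EAE : E *b A *b E = (hdot (A x) x / hdot x x) *: E.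
  apply: bop_ext => v; rewrite !bop_compE bop_scaleE [E v]EE !bopZ [E (A x)]EE.
  by rewrite !scalerA; congr (_ *: _); ring.
have [v ev0] : exists v, alpha t E v != 0.
  apply: contrapT => /forallNP nE.
  have /(e0_injective t0) EZ : alpha t E = 0.
    by apply: bop_ext => v; apply/eqP; apply: contrapT => h; apply: (nE v); apply/negP.
  by move: Ex x0; rewrite EZ => <-; rewrite eqxx.
set w := alpha t E v in ev0.
have ew : alpha t E w = w by rewrite /w -bop_compE -(e0_mul e0)// EEE.
have eAw : alpha t E (alpha t A w) = (hdot (A x) x / hdot x x) *: w.
  by rewrite /w -!bop_compE -!(e0_mul e0)// EAE (linear_funZ (cp_linear cp t0)).
have : `|alpha t E (alpha t A w)| <= M * `|w|.
  apply: le_trans (AM w); apply: projection_norm.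
    exact: (pu_positive (e0_positive_unital t0)).
  by rewrite -(e0_mul e0)// EEE.
rewrite eAw normrZ ler_pM2r ?normr_gt0// normrM normrV ?unitfE//.
rewrite hdot_norm normrX normr_id ler_pdivrMr//.
by rewrite exprn_gt0// normr_gt0.
Qed.

(** With the best constant [alpha t] is isometric; the factor 2 is harmless here. *)
Lemma e0_preimage_bound t A M : 0 <= t ->
  (forall v, `|alpha t A v| <= M * `|v|) ->
  forall v, `|A v| <= 2 * M * `|v|.
Proof.
by move=> t0 AM; apply: numerical_radius_norm; apply: (@e0_numerical_radius t).
Qed.
End injectivity.

(** * The weak* topology and normal states *)

Section weak_star_topology.
Context {R : realType}.
Implicit Types K : hilbertType R.

Lemma predual_form_continuous K (p : predual_pair K) :
  continuous (predual_form p : weak_star K -> R[i]).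
Proof.
move=> A.
have /cvg_sup/(_ p) h : nbhs (A : weak_star K) --> (A : weak_star K).
  exact: cvg_id.
apply: cvg_trans (cvg_app (predual_form p) h) _.
exact: (@initial_continuous _ _ (predual_form p)).
Qed.

Lemma cvg_weak_star K (T : Type) (F : set_system T) (FF : Filter F)
    (f : T -> 'B(K)) (A : 'B(K)) :
  (forall p, (fun t => predual_form p (f t)) @ F --> predual_form p A) ->
  (f : T -> weak_star K) @ F --> (A : weak_star K).
Proof.
move=> h; apply/cvg_sup => p.
move=> U [? /= [[W oW <-]]] /= WA /filterS; apply; apply: (h p).
exact: open_nbhs_nbhs.
Qed.

Lemma continuous_weak_star K (T : topologicalType) (f : T -> 'B(K)) :
  (forall p, continuous (fun t => predual_form p (f t) : R[i])) ->
  continuous (f : T -> weak_star K).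
Proof. by move=> h t; apply: cvg_weak_star => p; exact: h. Qed.

Lemma vector_state_normal K (x : K) : `|x| = 1 ->
  normal_state (fun A : 'B(K) => hdot (A x) x).
Proof.
move=> x1; split.
- by move=> a A B; rewrite bop_addE bop_scaleE hdotDl hdotZl.
- by move=> A; apply.
- by rewrite bop_idE hdot_norm x1 expr1n.
(* The vector state is the functional of the pair of sequences x, 0, 0, ... *)
pose xs (n : nat) : K := if n == 0%N then x else 0.
have stop (V : normedModType R[i]) (u : nat -> V) :
    (forall n, u n.+1 = 0) -> series u @ \oo --> u 0%N.
  move=> u0; apply: cvg_near_cst; exists 1%N => // -[//|n] _ /=.
  by rewrite /series/= big_nat_recl// big1 ?addr0.
have xs2 : square_summable xs.
  apply/cvg_ex; exists (`|xs 0%N| ^+ 2).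
  by apply: (stop _ (fun n => `|xs n| ^+ 2)) => n; rewrite /= normr0 expr0n.
pose p : predual_pair K := exist _ (xs, xs) (conj xs2 xs2).
have -> : (fun A : 'B(K) => hdot (A x) x) = predual_form p.
  apply/funext => A; apply/esym/cvg_lim; first exact: norm_hausdorff.
  apply: (stop _ (fun n => hdot (A (xs n)) (xs n))) => n.
  by rewrite /= bop0 hdot0l.
exact: predual_form_continuous.
Qed.

Lemma functional_norm_ge K (f : 'B(K) -> R[i]) (A : 'B(K)) :
  (forall v, `|A v| <= `|v|) -> ((complex.Re `|f A|)%:E <= functional_norm f)%E.
Proof.
move=> A1; apply: ereal_sup_ubound; exists A => //=.
apply: ub_ereal_sup => _ [v /= v1 <-].
rewrite lee_fin -lecR -ge0_complexE//.
exact: le_trans (A1 v) v1.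
Qed.

(** The difference of the two vector states at [S] is the value of their
    difference, composed with [phi t], at preimages of [S] that stay bounded as
    [t] grows; purity makes it vanish. *)
Lemma pure_vector_state K (phi : R -> 'B(K) -> 'B(K)) (S : 'B(K)) (M : R[i])
    (x y : K) : CP_semigroup phi -> pure phi -> 0 < M ->
  (forall t : R, 0 <= t -> exists2 B, phi t B = S &
     forall v, `|B v| <= M * `|v|) ->
  `|x| = 1 -> `|y| = 1 -> hdot (S x) x = hdot (S y) y.
Proof.
move=> cp pp M0 SB x1 y1.
have := pp _ _ (vector_state_normal x1) (vector_state_normal y1).
set z := hdot (S x) x - hdot (S y) y => lim0.
have : ((complex.Re `|(M^-1 : R[i]) * z|)%:E <= 0)%E.
  apply: cvge_ge lim0; near=> t.
  have t0 : 0 <= t by near: t; exact: nbhs_pinfty_ge.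
  have [B BS BM] := SB t t0.
  have -> : M^-1 * z = hdot (phi t (M^-1 *: B) x) x - hdot (phi t (M^-1 *: B) y) y.
    by rewrite (linear_funZ (cp_linear cp t0)) BS !bop_scaleE !hdotZl -mulrBr.
  apply: (@functional_norm_ge K
    (fun A => hdot (phi t A x) x - hdot (phi t A y) y)) => v.
  rewrite bop_scaleE normrZ gtr0_norm ?invr_gt0//.
  by rewrite ler_pdivrMl.
rewrite lee_fin -lecR -ge0_complexE// normr_le0 mulf_eq0 invr_eq0 gt_eqF//=.
by rewrite subr_eq0 => /eqP.
Unshelve. all: by end_near. Qed.

(** The quadratic form of [S] is constant on unit vectors. *)
Lemma pure_tail_scalar K (phi : R -> 'B(K) -> 'B(K)) (S : 'B(K)) (M : R[i]) :
  CP_semigroup phi -> pure phi -> 0 < M ->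
  (forall t : R, 0 <= t -> exists2 B, phi t B = S &
     forall v, `|B v| <= M * `|v|) ->
  exists c, S = c *: bop_id K.
Proof.
move=> cp pp M0 SB.
have [[x x0]|/forallNP K0] := pselect (exists x : K, x != 0); last first.
  exists 0; apply: bop_ext => v; rewrite scale0r.
  have -> : v = 0 by apply/eqP; apply: contrapT => /negP; exact: K0.
  by rewrite !bop0.
have unit_norm (v : K) : v != 0 -> `|(`|v|^-1 : R[i]) *: v| = 1.
  by move=> v0; rewrite normrZ normrV ?unitfE ?normr_eq0// normr_id mulVf ?normr_eq0.
set u := (`|x|^-1 : R[i]) *: x.
exists (hdot (S u) u); apply/eqP; rewrite -subr_eq0; apply/eqP.
apply: quadratic_form_eq0 => v.
have [->|v0] := eqVneq v 0; first by rewrite bop0 hdot0l.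
rewrite (pure_vector_state cp pp M0 SB (unit_norm _ x0) (unit_norm _ v0)).
rewrite bop_subE bop_scaleE bop_idE hdotBl !bopZ !hdotZl !hdotZr hdot_norm.
rewrite fmorphV/= (CrealP (normr_real _)).
have nv0 : `|v| != 0 by rewrite normr_eq0.
by field.
Qed.
End weak_star_topology.

Section strong_convergence.
Context {R : realType}.

(** Dominated convergence for the series defining a normal functional. *)
Lemma strong_cvg_weak_star (V : hilbertType R) (e : nat -> 'B(V)) (A : 'B(V)) :
  (forall n v, `|e n v| <= `|v|) -> (forall v, `|A v| <= `|v|) ->
  (forall v, e n v @[n --> \oo] --> A v) ->
  (e : nat -> weak_star V) @ \oo --> (A : weak_star V).
Proof.
move=> e1 A1 eA; apply: cvg_weak_star => -[[x y] [/= x2 y2]].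
set p := exist _ _ _.
pose b k := `|x k| ^+ 2 + `|y k| ^+ 2.
have cb : cvgn (series b) by exact: (is_cvg_seriesD x2 y2).
have xyb k : `|x k| * `|y k| <= b k.
  have [le|/ltW le] := real_leP (normr_real (x k)) (normr_real (y k)).
    apply: (@le_trans _ _ (`|y k| ^+ 2)); first by rewrite expr2 ler_wpM2r.
    by rewrite lerDr exprn_ge0.
  apply: (@le_trans _ _ (`|x k| ^+ 2)); first by rewrite expr2 ler_wpM2l.
  by rewrite lerDl exprn_ge0.
have bound (B : 'B(V)) k : (forall v, `|B v| <= `|v|) ->
    `|hdot (B (x k)) (y k)| <= b k.
  move=> B1; apply: le_trans (cauchy_schwarz _ _) _.
  by apply: le_trans (xyb k); rewrite ler_wpM2r.
pose a (B : 'B(V)) k := hdot (B (x k)) (y k).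
have ca (B : 'B(V)) : (forall v, `|B v| <= `|v|) -> series (a B) @ \oo --> predual_form p B.
  move=> B1; have : cvgn (series (a B)) by apply: complex_dominated_series cb => k; exact: bound.
  by [].
apply/cvgrPdist_lt => eps eps0.
have eps8 : 0 < eps / 8 by rewrite divr_gt0// ltr0n.
have /cvg_cauchy/cauchy_seriesP/(_ _ eps8) := cb.
move=> [[U1 U2] /= [[N1 _ U1N] [N2 _ U2N]] UN].
pose N := maxn N1 N2.
have tailb m : (N <= m)%N -> \sum_(N <= k < m) b k <= eps / 8.
  move=> Nm; have := UN (N, m) => /= h; apply/ltW.
  have : `|\sum_(N <= k < m) b k| < eps / 8.
    apply: h; split => /=; first by apply: U1N; rewrite /= leq_maxl.
    by apply: U2N; rewrite /= (leq_trans (leq_maxr _ _) Nm).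
  by rewrite ger0_norm// sumr_ge0// => k _; rewrite addr_ge0// exprn_ge0.
(* The first N terms converge one by one; the others are dominated by b. *)
have head : (fun n => \sum_(0 <= k < N) (a A k - a (e n) k)) @ \oo --> (0 : R[i]).
  rewrite [X in _ --> X](_ : 0 = \sum_(0 <= k < N) (0 : R[i])); last by rewrite big1.
  apply: cvg_big => [|k _]; first exact: add_continuous.
  rewrite -(subrr (a A k)); apply: cvgB; first exact: cvg_cst.
  apply: (cvg_trans (cvg_app (fun w => hdot w (y k)) (eA (x k)))).
  exact: hdot_continuous.
move/cvgr0Pnorm_lt : head => /(_ (eps / 4)).
rewrite divr_gt0 ?ltr0n// => /(_ isT); apply: filterS => n head.
have dE m : series (a A) m - series (a (e n)) m = \sum_(0 <= k < m) (a A k - a (e n) k).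
  by rewrite /series/= -sumrB.
apply: (@le_lt_trans _ _ (eps / 2)); last first.
  by rewrite ltr_pdivrMr ?ltr0n// ltr_pMr// ltr1n.
apply: (norm_lim_le (cvgB (ca _ A1) (ca _ (e1 n)))).
exists N => // m /= Nm.
rewrite -[X in `|X|]/(series (a A) m - series (a (e n)) m) dE.
rewrite (big_cat_nat (n := N))//=.
have -> : eps / 2 = eps / 4 + 2 * (eps / 8) by field.
apply: le_trans (ler_normD _ _) _; apply: lerD; first exact: ltW.
apply: le_trans (ler_norm_sum _ _ _) _.
apply: le_trans (_ : \sum_(N <= k < m) (b k + b k) <= _).
  apply: ler_sum => k _; apply: le_trans (ler_normB _ _) _.
  by apply: lerD; apply: bound.
by rewrite big_split/= mulr_natl mulr2n lerD// tailb.
Qed.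
End strong_convergence.

Section states.
Context {R : realType}.
Variables (V : hilbertType R) (rho : 'B(V) -> R[i]).
Hypothesis ns : normal_state rho.

Let lin_rho : linear (rho : 'B(V) -> R[i]^o) := state_linear ns.

(** The null space of a state absorbs products. Expanding the positive operator
    [(X + z^* Q) (X' + z Q)], the state takes the value
    [rho(XX') + z rho(XQ) + z^* rho(QX')], which is nonnegative for all [z]. *)
Lemma state_mul_null Q X X' : adjoint_op Q Q -> Q *b Q = Q -> rho Q = 0 ->
  adjoint_op X X' -> rho (X *b Q) = 0 /\ rho (Q *b X') = 0.
Proof.
move=> QQ Q2 rQ XX; apply: (@affine_ge0_complex _ (rho (X *b X'))) => z.
have -> : rho (X *b X') + (z * rho (X *b Q) + z^* * rho (Q *b X'))
    = rho (X *b X' + (z *: (X *b Q) + (z^* *: (Q *b X') + (z * z^*) *: Q))).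
  by rewrite !(linear_funD lin_rho) !(linear_funZ lin_rho) rQ scaler0 addr0.
apply: (state_ge0 ns) => v.
have -> : hdot ((X *b X' + (z *: (X *b Q) + (z^* *: (Q *b X') + (z * z^*) *: Q))) v) v
    = hdot (X' v + z *: Q v) (X' v + z *: Q v).
  rewrite !bop_addE !bop_scaleE !bop_compE !hdotDl !hdotDr !hdotZl !hdotZr.
  rewrite !XX !(QQ _ v).
  rewrite (_ : hdot (Q v) (Q v) = hdot v (Q v)); last first.
    by rewrite QQ -bop_compE Q2.
  by ring.
exact: hdot_ge0.
Qed.

(** Since [1 - P] is null, the terms of [X = PXP + PX(1 - P) + (1 - P)X] other
    than the first are null. *)
Lemma state_compression (P X : 'B(V)) : positive_op P -> P *b P = P ->
  rho P = 1 -> rho (P *b X *b P) = rho X.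
Proof.
move=> P0 PP rP; have Pa := positive_op_self_adjoint P0.
have PPv v : P (P v) = P v by rewrite -bop_compE PP.
pose Q := bop_id V - P.
have QE v : Q v = v - P v by [].
have Qa : adjoint_op Q Q by move=> x y; rewrite !QE hdotBl hdotBr Pa.
have Q2 : Q *b Q = Q.
  by apply: bop_ext => v; rewrite bop_compE !QE bopB PPv subrr subr0.
have rQ : rho Q = 0.
  by rewrite /Q (linear_funB lin_rho) (state1 ns) rP subrr.
have [X' XX'] := adjoint_ex X.
have [_ r1] := state_mul_null Qa Q2 rQ (adjoint_op_sym XX').
have [r2 _] := state_mul_null Qa Q2 rQ (adjoint_op_comp Pa XX').
have {2}-> : X = P *b X *b P + ((P *b X) *b Q + Q *b X).
  apply: bop_ext => v; rewrite !bop_addE !bop_compE !QE bopB bopB.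
  by rewrite addrA subrKC subrKC.
by rewrite !(linear_funD lin_rho) r1 r2 !addr0.
Qed.
End states.

(** * Compression of a dilation *)

Section dense_span.
Context {R : realType}.

Lemma dense_span_eq0 (V : hilbertType R) (S : set V) (f : V -> R[i]^o) :
  linear f -> continuous f -> closure (linear_span S) = setT ->
  (forall v, S v -> f v = 0) -> forall v, f v = 0.
Proof.
move=> lf cf clS fS v; apply/eqP; apply: contraT => fv0.
have : closure (linear_span S) v by rewrite clS.
have /cvgrPdist_lt/(_ `|f v|) := cf v; rewrite normr_gt0 => /(_ fv0) fU.
move=> /(_ _ fU)[_ [[n [c [w [Sw ->]]]] /=]].
have -> : f (\sum_(i < n) c i *: w i) = 0.
  rewrite (linear_fun_sum lf) big1// => i _.
  by rewrite (linear_funZ lf) fS ?scaler0.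
by rewrite subr0 ltxx.
Qed.
End dense_span.

Section minimal_dilation_theory.
Variables (R : realType) (K H : hilbertType R).
Variables (phi : R -> 'B(K) -> 'B(K)) (alpha : R -> 'B(H) -> 'B(H)).
Variables (J : bop K H) (J' : bop H K).
Hypothesis cp_phi : CP_semigroup phi.
Hypothesis emb : subspace_embedding J J'.
Hypothesis e0 : E0_semigroup alpha.
Hypothesis dil : dilation J J' phi alpha.
Let cp_alpha := e0_cp e0.
Local Notation P := (subspace_proj J J').

Definition compress (X : 'B(H)) : 'B(K) := J' *b X *b J.

Lemma compressE X x : compress X x = J' (X (J x)).
Proof. by []. Qed.

Lemma cornerE (A : 'B(K)) v : corner J J' A v = J (A (J' v)).
Proof. by []. Qed.

Lemma projE v : P v = J (J' v).
Proof. by []. Qed.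

Lemma hdot_embed x y : hdot (J x) y = hdot x (J' y).
Proof. exact: embedding_adjoint. Qed.

Lemma hdot_coembed y x : hdot (J' y) x = hdot y (J x).
Proof. by rewrite hdotC -hdot_embed -hdotC. Qed.

Lemma embedK x : J' (J x) = x.
Proof.
apply/eqP; rewrite -subr_eq0; apply/eqP; apply: hdot_eq0P => y.
by rewrite hdotBl hdot_coembed (embedding_isometric emb) subrr.
Qed.

Lemma norm_embed x : `|J x| = `|x|.
Proof.
apply/eqP; rewrite -(@eqrXn2 _ 2)// -!hdot_norm.
by rewrite (embedding_isometric emb).
Qed.

Lemma norm_coembed v : `|J' v| <= `|v|.
Proof.
have [->|v0] := eqVneq (J' v) 0; first by rewrite normr0.
rewrite -(@ler_pM2r _ `|J' v|) ?normr_gt0//.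
have -> : `|J' v| * `|J' v| = `|hdot v (J (J' v))|.
  by rewrite -hdot_coembed hdot_norm normrX normr_id expr2.
by apply: le_trans (cauchy_schwarz _ _) _; rewrite norm_embed.
Qed.

Lemma proj_positive : positive_op P.
Proof. by move=> v; rewrite projE hdot_embed; exact: hdot_ge0. Qed.

Lemma proj_idem : P *b P = P.
Proof. by apply: bop_ext => v; rewrite bop_compE !projE embedK. Qed.

Lemma corner_id : corner J J' (bop_id K) = P.
Proof. by apply: bop_ext. Qed.

Lemma alpha_proj_idem t : 0 <= t -> alpha t P *b alpha t P = alpha t P.
Proof. by move=> t0; rewrite -(e0_mul e0)// proj_idem. Qed.

Lemma alpha_proj_adjoint t : 0 <= t -> adjoint_op (alpha t P) (alpha t P).
Proof.
move=> t0; apply/positive_op_self_adjoint/(pu_positive (e0_positive_unital e0 t0)).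
exact: proj_positive.
Qed.

(** This is [alpha t P >= P]: the projection [alpha t P] preserves the norm of
    [J x] because [phi] is unital. *)
Lemma alpha_proj_embed t x : 0 <= t -> alpha t P (J x) = J x.
Proof.
move=> t0; have ad := alpha_proj_adjoint t0.
have PeJ : P (alpha t P (J x)) = J x.
  have := dil t0 (bop_id K); rewrite (cp_unital cp_phi t0) corner_id.
  move=> /(congr1 (fun X : 'B(H) => X (J x))).
  by rewrite /= !embedK.
have eJJ : hdot (J x) (alpha t P (J x)) = hdot (J x) (J x).
  have := congr1 (hdot (J x)) PeJ.
  by rewrite projE -hdot_coembed embedK -hdot_embed.
have eeJ : alpha t P (alpha t P (J x)) = alpha t P (J x).
  by rewrite -[LHS]bop_compE alpha_proj_idem.
apply/esym/eqP; rewrite -subr_eq0 -hdot_eq0 hdotBl !hdotBr eJJ !ad eeJ eJJ.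
by rewrite !subrr.
Qed.

Lemma coembed_alpha_proj t v : 0 <= t -> J' (alpha t P v) = J' v.
Proof.
move=> t0; apply/eqP; rewrite -subr_eq0; apply/eqP; apply: hdot_eq0P => x.
rewrite hdotBl !hdot_coembed (alpha_proj_adjoint t0).
by rewrite alpha_proj_embed// subrr.
Qed.

(** The dilation property is given for operators [X] of the corner; it extends to
    all [X] because [alpha t P] fixes the range of [J]. *)
Lemma compress_alpha t X : 0 <= t -> compress (alpha t X) = phi t (compress X).
Proof.
move=> t0; apply: bop_ext => x.
have := dil t0 (compress X) => /(congr1 (fun Y : 'B(H) => J' (Y (J x)))).
have -> : corner J J' (compress X) = P *b X *b P by apply: bop_ext.
rewrite !(e0_mul e0)// cornerE !bop_compE !embedK => ->.
by rewrite coembed_alpha_proj// alpha_proj_embed.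
Qed.

(** * The tail algebra *)

Local Notation word := (seq (R * 'B(K))).

Definition nonneg_times (s : word) := forall p, p \in s -> 0 <= p.1.

Definition word_op (s : word) : 'B(H) :=
  foldr (fun p X => alpha p.1 (corner J J' p.2) *b X) (bop_id H) s.

Lemma word_opE s v :
  foldr (fun p y => alpha p.1 (corner J J' p.2) y) v s = word_op s v.
Proof. by elim: s => //= p s ->. Qed.

Lemma word_op_cat s1 s2 : word_op (s1 ++ s2) = word_op s1 *b word_op s2.
Proof. by apply: bop_ext => v; rewrite bop_compE -!word_opE foldr_cat. Qed.

(** Words factor through [alpha s] when their times are at least [s]. *)
Definition advance (s : R) (w : word) : word := [seq (p.1 - s, p.2) | p <- w].

Lemma word_op_advance s w : 0 <= s -> (forall p, p \in w -> s <= p.1) ->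
  word_op w = alpha s (word_op (advance s w)).
Proof.
move=> s0; elim: w => [|p w IHw] sw /=; first by rewrite (cp_unital cp_alpha).
rewrite IHw; last by move=> q qw; apply: sw; rewrite inE qw orbT.
rewrite (e0_mul e0)// -(cp_add cp_alpha)// ?subr_ge0 ?sw ?mem_head//.
by rewrite addrC subrK.
Qed.

Lemma nonneg_times_advance s w : (forall p, p \in w -> s <= p.1) ->
  nonneg_times (advance s w).
Proof. by move=> sw _ /mapP[p pw ->] /=; rewrite subr_ge0 sw. Qed.

(** The adjoint of a word is the reversed word of the adjoint letters. *)
Lemma word_op_adjoint w : nonneg_times w ->
  exists2 w', nonneg_times w' & adjoint_op (word_op w) (word_op w').
Proof.
elim: w => [|[t A] w IHw] w0; first by exists [::] => // x y.
have [w' w'0 ww'] : exists2 w', nonneg_times w' & adjoint_op (word_op w) (word_op w').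
  by apply: IHw => p pw; apply: w0; rewrite inE pw orbT.
have t0 : 0 <= t by apply: (w0 (t, A)); rewrite mem_head.
have [B AB] := adjoint_ex A.
exists (w' ++ [:: (t, B)]).
  move=> p; rewrite mem_cat inE => /orP[/w'0//|/eqP->//].
rewrite word_op_cat; apply: adjoint_op_comp => //.
have -> : word_op [:: (t, B)] = alpha t (corner J J' B) by apply: bop_ext.
apply: positive_unital_adjoint; first exact: e0_positive_unital.
by move=> x y; rewrite !cornerE hdot_embed AB hdot_coembed.
Qed.

Lemma earliest_letter (w : word) : (0 < size w)%N ->
  exists2 p, p \in w & forall q, q \in w -> p.1 <= q.1.
Proof.
elim: w => // p [|p' w] IHw _.
  by exists p; rewrite ?mem_head// => q; rewrite inE => /eqP->.
have [//|q qw qmin] := IHw.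
have [pq|/ltW qp] := leP p.1 q.1.
  exists p; rewrite ?mem_head// => r; rewrite inE => /orP[/eqP->//|/qmin].
  exact: le_trans.
exists q; first by rewrite inE qw orbT.
by move=> r; rewrite inE => /orP[/eqP->//|/qmin].
Qed.

Definition tail : set 'B(H) := \bigcap_(t in [set t : R | 0 <= t]) range (alpha t).

(** The maps [alpha s] restrict to automorphisms of the tail, by injectivity. *)
Lemma tail_alpha_inv s D : 0 <= s -> tail (alpha s D) -> tail D.
Proof.
move=> s0 tD t /= t0; have [E _] := tD (s + t) (addr_ge0 s0 t0).
by rewrite (cp_add cp_alpha)// => /(e0_inj e0 s0) <-; exists E.
Qed.

Lemma tail_sub_scalar D c : tail D -> tail (D - c *: bop_id H).
Proof.
move=> tD t t0; have [E _ <-] := tD t t0; exists (E - c *: bop_id H) => //.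
rewrite (linear_funB (cp_linear cp_alpha t0)) (linear_funZ (cp_linear cp_alpha t0)).
by rewrite (cp_unital cp_alpha).
Qed.

(** The compression of [D = alpha t (B t)] is [phi t] applied to the compression
    of [B t], which is bounded uniformly in [t]. *)
Lemma compress_tail D : pure phi -> tail D -> exists c, compress D = c *: bop_id K.
Proof.
move=> pp tD; have [M M0 DM] := bop_bounded D.
apply: (@pure_tail_scalar _ _ phi _ (2 * M)) => //.
  by rewrite mulr_gt0// ltr0n.
move=> t t0; have [B _ BD] := tD t t0; exists (compress B).
  by rewrite -compress_alpha// BD.
move=> v; rewrite compressE; apply: le_trans (norm_coembed _) _.
rewrite -(norm_embed v); apply: (e0_preimage_bound e0 t0).
by rewrite BD.
Qed.

(** The compression of a tail element is a scalar, and [phi s] fixes scalars. *)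
Lemma compress_tail_alpha s D : pure phi -> 0 <= s -> tail (alpha s D) ->
  compress (alpha s D) = 0 -> compress D = 0.
Proof.
move=> pp s0 /(tail_alpha_inv s0)/(compress_tail pp)[c Dc].
rewrite compress_alpha// Dc => <-.
by rewrite (linear_funZ (cp_linear cp_phi s0)) (cp_unital cp_phi).
Qed.

(** The key cancellation, by induction on the number of letters. Let [s] be the
    smallest time of a letter. Everything factors through [alpha s], so the left
    side is [phi s] applied to a compressed product in which that letter [C] has
    time 0. A corner operator equals [P C P], so it cuts this product at two
    compressions; the one containing [D] has fewer letters and vanishes. *)
Lemma compress_word_tail n (X Y : word) D : pure phi ->
  (size X + size Y <= n)%N -> nonneg_times X -> nonneg_times Y ->
  tail D -> compress D = 0 ->
  forall x, J' (word_op X (D (word_op Y (J x)))) = 0.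
Proof.
move=> pp; elim: n X Y D => [|n IHn] X Y D.
  rewrite leqn0 addn_eq0 !size_eq0 => /andP[/eqP-> /eqP->] _ _ _ D0 x.
  by rewrite -[LHS]/(compress D x) D0.
move=> sXY X0 Y0 tD D0 x.
have [|XY0] := posnP (size (X ++ Y)).
  move/eqP; rewrite size_cat addn_eq0 !size_eq0 => /andP[/eqP-> /eqP->].
  by rewrite -[LHS]/(compress D x) D0.
have [[s C] pXY pmin] := earliest_letter XY0.
have s0 : 0 <= s.
  by move: pXY; rewrite mem_cat => /orP[/X0|/Y0].
have [D' _ DD'] := tD s s0.
have tD' : tail D' by apply: (tail_alpha_inv s0); rewrite DD'.
have D'0 : compress D' = 0.
  by apply: (compress_tail_alpha pp s0); rewrite DD'.
have sX p : p \in X -> s <= p.1 by move=> pX; apply: pmin; rewrite mem_cat pX.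
have sY p : p \in Y -> s <= p.1.
  by move=> pY; apply: pmin; rewrite mem_cat pY orbT.
pose Z := word_op (advance s X) *b D' *b word_op (advance s Y).
have -> : word_op X (D (word_op Y (J x))) = alpha s Z (J x).
  by rewrite (word_op_advance s0 sX) (word_op_advance s0 sY) -DD' /Z !(e0_mul e0).
rewrite -[LHS]/(compress (alpha s Z) x) compress_alpha//.
suff -> : compress Z = 0 by rewrite (linear_fun0 (cp_linear cp_phi s0)).
apply: bop_ext => y; rewrite compressE /Z !bop_compE.
have letter0 : alpha (s - s) (corner J J' C) = corner J J' C.
  by rewrite subrr (cp_0 cp_alpha).
move: pXY; rewrite mem_cat => /orP[pX|pY].
- case/splitPr : pX sXY X0 sX {XY0 pmin Z} => X1 X2 sXY X0 sX.
  rewrite /advance map_cat word_op_cat /= letter0 !bop_compE.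
  rewrite IHn ?bop0//.
  + by move: sXY; rewrite !size_map size_cat/= addnS addSn ltnS; apply: leq_trans;
      rewrite -addnA leq_addl.
  + by apply: nonneg_times_advance => p pX; apply: sX; rewrite mem_cat inE pX !orbT.
  + exact: nonneg_times_advance.
- case/splitPr : pY sXY Y0 sY {XY0 pmin Z} => Y1 Y2 sXY Y0 sY.
  rewrite /advance map_cat word_op_cat /= letter0 !bop_compE.
  rewrite IHn//.
  + by move: sXY; rewrite !size_map size_cat/= !addnS ltnS; apply: leq_trans;
      rewrite leq_add2l leq_addr.
  + exact: nonneg_times_advance.
  + by apply: nonneg_times_advance => p pY; apply: sY; rewrite mem_cat pY.
Qed.

Hypothesis dense_vectors :
  closure (linear_span (dilation_vectors J J' alpha)) = setT.

(** By [compress_word_tail] the vector [D v], for [v] a dilation vector, is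
    orthogonal to all dilation vectors: a word applied on the other side of the
    inner product becomes the adjoint word applied to [D v]. *)
Lemma tail_compress_eq0 D : pure phi -> tail D -> compress D = 0 -> D = 0.
Proof.
move=> pp tD D0.
have Dw v : dilation_vectors J J' alpha v -> D v = 0.
  move=> [Y [x [_ Y0 ->]]]; rewrite word_opE; apply: hdot_eq0P => w.
  rewrite hdotC; apply/eqP; rewrite conjC_eq0; apply/eqP; move: w.
  apply: (dense_span_eq0 _ _ dense_vectors).
  - by move=> a u u'; rewrite hdotDl hdotZl.
  - exact: hdot_continuous.
  move=> _ [X [y [_ X0 ->]]]; rewrite word_opE.
  have [X' X'0 XX'] := word_op_adjoint X0.
  rewrite XX' hdot_embed.
  by rewrite (@compress_word_tail (size X' + size Y)) // hdot0r.
apply: bop_ext => v; apply: hdot_eq0P => w; move: v.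
apply: (dense_span_eq0 _ _ dense_vectors).
- by move=> a u u'; rewrite bopD bopZ hdotDl hdotZl.
- move=> u; apply: (@continuous_comp _ _ _ D (fun z => hdot z w)).
    exact: bop_continuous.
  exact: hdot_continuous.
by move=> u /Dw ->; rewrite hdot0l.
Qed.

Lemma tail_trivial : pure phi -> tail = [set c *: bop_id H | c in [set: R[i]]].
Proof.
move=> pp; apply/seteqP; split => [D tD|_ [c _ <-] t /= t0]; last first.
  exists (c *: bop_id H) => //.
  by rewrite (linear_funZ (cp_linear cp_alpha t0)) (cp_unital cp_alpha).
have [c Dc] := compress_tail pp tD; exists c => //.
apply/esym/eqP; rewrite -subr_eq0; apply/eqP.
apply: tail_compress_eq0 => //; first exact: tail_sub_scalar.
apply: bop_ext => x; rewrite compressE bop_subE bop_scaleE bop_idE.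
by rewrite bopB bopZ embedK -compressE Dc bop_scaleE bop_idE subrr.
Qed.
End minimal_dilation_theory.

(** * Invariant states of the dilation *)

Section invariant_states.
Variables (R : realType) (K H : hilbertType R).
Variables (phi : R -> 'B(K) -> 'B(K)) (alpha : R -> 'B(H) -> 'B(H)).
Variables (J : bop K H) (J' : bop H K).
Hypothesis cp_phi : CP_semigroup phi.
Hypothesis emb : subspace_embedding J J'.
Hypothesis e0 : E0_semigroup alpha.
Hypothesis dil : dilation J J' phi alpha.
Hypothesis dense_vectors :
  closure (linear_span (dilation_vectors J J' alpha)) = setT.
Let cp_alpha := e0_cp e0.
Local Notation P := (subspace_proj J J').

(** If the first letter of [v] has time [T <= t], then [alpha t P] is [alpha T] of
    the projection [alpha (t - T) P], which fixes the range of that letter. *)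
Lemma alpha_proj_vector v : dilation_vectors J J' alpha v ->
  exists2 T : R, 0 <= T & forall t, T <= t -> alpha t P v = v.
Proof.
move=> [[|[T A] s] [x [//= _ s0 ->]]].
have T0 : 0 <= T by apply: (s0 (T, A)); rewrite mem_head.
exists T => // t Tt; set w := foldr _ _ _.
have u0 : 0 <= t - T by rewrite subr_ge0.
rewrite -(subrK T t) addrC (cp_add cp_alpha)// -bop_compE -(e0_mul e0)//.
congr (alpha _ _ _); apply: bop_ext => u.
by rewrite bop_compE cornerE (alpha_proj_embed cp_phi emb e0 dil).
Qed.

Lemma alpha_proj_span v : linear_span (dilation_vectors J J' alpha) v ->
  exists2 T : R, 0 <= T & forall t, T <= t -> alpha t P v = v.
Proof.
move=> [n [c [w [Sw ->]]]].
have /choice[T TP] i : exists T : R, 0 <= T /\ forall t, T <= t -> alpha t P (w i) = w i.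
  by have [T T0 Tw] := alpha_proj_vector (Sw i); exists T.
(* The sum of the nonnegative times bounds each of them. *)
exists (\sum_(i < n) T i); first by apply: sumr_ge0 => i _; have [] := TP i.
move=> t Tt; rewrite linear_sum; apply: eq_bigr => i _.
rewrite linearZ_LR/=; congr (_ *: _); apply: (TP i).2.
apply: le_trans Tt; rewrite (bigD1 i)//= lerDl.
by apply: sumr_ge0 => j _; have [] := TP j.
Qed.

Lemma alpha_proj_contraction t v : 0 <= t -> `|alpha t P v| <= `|v|.
Proof.
move=> t0; apply: projection_norm; last exact: alpha_proj_idem.
exact/(pu_positive (e0_positive_unital e0 t0))/proj_positive.
Qed.

(** Contractions that converge on a dense subspace converge strongly. *)
Lemma alpha_proj_cvg v : alpha n%:R P v @[n --> \oo] --> v.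
Proof.
apply/cvgrPdist_lt => e ep0.
have e20 : 0 < e / 2 by rewrite divr_gt0.
have : closure (linear_span (dilation_vectors J J' alpha)) v by rewrite dense_vectors.
move=> /(_ _ (nbhsx_ballx v _ e20))[w [/alpha_proj_span[T T0 Tw]]].
rewrite -ball_normE/= => vw.
exists (Num.trunc T).+1 => // n /= Tn.
have {}Tn : T <= n%:R.
  by apply/ltW; apply: lt_le_trans (truncnS_gt T) _; rewrite ler_nat.
have -> : v - alpha n%:R P v = (v - w) + alpha n%:R P (w - v).
  by rewrite bopB Tw// addrA subrK.
apply: le_lt_trans (ler_normD _ _) _; rewrite [ltRHS]splitr ltr_leD//.
apply: le_trans (alpha_proj_contraction _ (ler0n _ _)) _.
by rewrite distrC ltW.
Qed.

(** The state takes the same value at all the [alpha n P], which converge to 1. *)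
Lemma invariant_state_proj (rho : 'B(H) -> R[i]) :
  normal_invariant_state alpha rho -> rho P = 1.
Proof.
move=> [ns inv].
have cv : ((fun n => alpha n%:R P) : nat -> weak_star H) @ \oo
    --> (bop_id H : weak_star H).
  apply: strong_cvg_weak_star.
  - by move=> n v; apply: alpha_proj_contraction; exact: ler0n.
  - by [].
  - exact: alpha_proj_cvg.
have h : (fun n => rho (alpha n%:R P)) @ \oo --> rho (bop_id H).
  apply: (cvg_trans (cvg_app rho cv)).
  exact: (state_normal ns).
have h' : (fun n => rho (alpha n%:R P)) @ \oo --> rho P.
  rewrite (_ : (fun n => _) = fun=> rho P); first exact: cvg_cst.
  by apply/funext => n; rewrite inv// ler0n.
rewrite -(state1 ns); apply: cvg_unique h' h.
exact: norm_hausdorff.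
Qed.

(** Composing with [corner J J'] replaces the vectors of a pair of sequences by
    their images under [J']. *)
Lemma corner_continuous :
  continuous (corner J J' : weak_star K -> weak_star H).
Proof.
apply: continuous_weak_star => -[[x y] [/= x2 y2]].
have sqs (z : nat -> H) : square_summable z -> square_summable (fun n => J' (z n)).
  move=> z2; apply: complex_dominated_series z2 => n.
  rewrite normrX normr_id; apply: lerXn2r; rewrite ?nnegrE//.
  exact: (norm_coembed emb).
pose p : predual_pair K :=
  exist _ (fun n => J' (x n), fun n => J' (y n)) (conj (sqs _ x2) (sqs _ y2)).
rewrite [X in continuous X](_ : _ = predual_form p :> (weak_star K -> R[i])).
  exact: predual_form_continuous.
apply/funext => A; rewrite /predual_form/=; congr (limn (series _)).
by apply/funext => n; rewrite (hdot_embed emb).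
Qed.

Lemma invariant_state_compression (rho : 'B(H) -> R[i]) :
  normal_invariant_state alpha rho ->
  normal_invariant_state phi (fun A => rho (corner J J' A)).
Proof.
move=> ri; have rP := invariant_state_proj ri.
have [ns inv] := ri; split; last first.
  move=> t t0 A; rewrite (dil t0 A) (state_compression ns)// ?inv//.
  - exact: proj_positive.
  - exact: proj_idem.
split.
- move=> a A B; rewrite -(state_linear ns); congr rho.
  by apply: bop_ext => v; rewrite !cornerE bop_addE bop_scaleE bopD bopZ.
- move=> A A0; apply: (state_ge0 ns) => v.
  by rewrite cornerE (hdot_embed emb).
- by rewrite corner_id.
- move=> A; apply: (cvg_trans (cvg_app rho (@corner_continuous A))).
  exact: (state_normal ns).
Qed.
End invariant_states.

Theorem proposition3p5 (R : realType) (K H : hilbertType R)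
    (phi : R -> 'B(K) -> 'B(K)) (alpha : R -> 'B(H) -> 'B(H))
    (J : bop K H) (J' : bop H K) :
  separable K -> separable H ->
  CP_semigroup phi -> pure phi ->
  ~ (exists rho : 'B(K) -> R[i], normal_invariant_state phi rho) ->
  subspace_embedding J J' ->
  E0_semigroup alpha ->
  minimal_dilation J J' phi alpha ->
  \bigcap_(t in [set t : R | 0 <= t]) range (alpha t) =
    [set c *: bop_id H | c in [set: R[i]]] /\
  ~ (exists rho : 'B(H) -> R[i], normal_invariant_state alpha rho).
Proof.
move=> _ _ cp pp no_inv emb e0 [dil dense_vectors]; split.
  exact: (tail_trivial cp emb e0 dil dense_vectors pp).
move=> [rho /(invariant_state_compression cp emb e0 dil dense_vectors) ri].
by apply: no_inv; eexists; exact: ri.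
Qed.
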